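(* For every $n\ge 1$ the following three enumerations are equivalent, i.e. the following three numbers are equal: (i) the number of complete exceptional sequences of $\Lambda_n$-modules, where $\Lambda_n$ is the linear radical square zero Nakayama algebra of rank $n$; (ii) the number of idempotent functions $f:\{1,\dots,n\}\to\{1,\dots,n\}$ (functions with $f\circ f=f$); (iii) the number of forests of rooted labeled trees of height at most one with $n$ vertices labeled by $1,\dots,n$.
   Context: Let $k$ be an algebraically closed field and let $\Lambda_n=kQ/\mathrm{rad}^2(kQ)$ where $Q$ is the linearly oriented quiver $1\to 2\to\cdots\to n$; finite-dimensional $\Lambda_n$-modules are identified with finite-dimensional representations of $Q$ in which the composition of any two consecutive arrows is zero. This $\Lambda_n$ is the linear radical square zero Nakayama algebra of rank $n$. A $\Lambda_n$-module $M$ is exceptional if it is indecomposable, $\mathrm{Hom}(M,M)\cong k$ and $\mathrm{Ext}^i(M,M)=0$ for all $i\ge 1$. A pair $(M,N)$ of exceptional modules is an exceptional pair if $\mathrm{Hom}(N,M)=0$ and $\mathrm{Ext}^i(N,M)=0$ for all $i\ge 1$. A sequence $(M_1,\dots,M_t)$ of exceptional $\Lambda_n$-modules is an exceptional sequence if $(M_i,M_j)$ is an exceptional pair for all $1\le i<j\le t$; it is complete if $t=n$. The entries of exceptional sequences are isomorphism classes of modules. A rooted labeled forest on $n$ vertices is a forest with vertex set $\{1,\dots,n\}$ together with a choice of one root in each connected component; it has height at most one if every vertex is either a root or adjacent to the root of its component. *)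

(* Defs.v *)
From HB Require Import structures.
From mathcomp Require Import all_boot all_order all_algebra.

Set Implicit Arguments.
Unset Strict Implicit.
Unset Printing Implicit Defensive.

Import GRing.Theory.
Local Open Scope ring_scope.

(* A finite-dimensional module over the linear radical square zero Nakayama
   algebra of rank n, given as a representation of 1 -> 2 -> ... -> n in which
   consecutive arrows compose to zero. Vertices are numbered from 0, and the
   arrow i -> j is the proof of j = i.+1, which is unique. *)
Record rep (k : fieldType) (n : nat) := Rep {
  rep_sp :> 'I_n -> vectType k;
  rep_arr : forall i j : 'I_n, nat_of_ord j = i.+1 ->
    'Hom(rep_sp i, rep_sp j);
  rep_rad2 : forall (i j l : 'I_n)
    (ij : nat_of_ord j = i.+1) (jl : nat_of_ord l = j.+1),
    (rep_arr jl \o rep_arr ij)%VF = 0 }.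

Section Category.
Variables (k : fieldType) (n : nat).
Implicit Types M N A B : rep k n.

Record rep_hom M N := RepHom {
  rep_map :> forall i : 'I_n, 'Hom(M i, N i);
  rep_mapP : forall (i j : 'I_n) (ij : nat_of_ord j = i.+1),
    (rep_map j \o rep_arr M ij)%VF = (rep_arr N ij \o rep_map i)%VF }.

Definition rep_iso M N : Prop :=
  exists (f : rep_hom M N) (g : rep_hom N M),
    (forall i, (g i \o f i)%VF = \1%VF) /\ (forall i, (f i \o g i)%VF = \1%VF).

Definition rep_zero M : Prop := forall i, \dim {: M i} = 0%N.

Definition pair_map (U U' V V' : vectType k) (f : 'Hom(U, U'))
  (g : 'Hom(V, V')) (x : U * V) : U' * V' := (f x.1, g x.2).

Lemma pair_map_is_linear (U U' V V' : vectType k) (f : 'Hom(U, U'))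
  (g : 'Hom(V, V')) : linear (pair_map f g).
Proof. by move=> a x y; rewrite /pair_map /= !linearP. Qed.

HB.instance Definition _ (U U' V V' : vectType k) (f : 'Hom(U, U'))
    (g : 'Hom(V, V')) :=
  GRing.isLinear.Build k (U * V)%type (U' * V')%type _ (pair_map f g)
    (pair_map_is_linear f g).

Definition dsum_arr A B (i j : 'I_n) (ij : nat_of_ord j = i.+1) :
    'Hom((A i * B i)%type, (A j * B j)%type) :=
  linfun (pair_map (rep_arr A ij) (rep_arr B ij)).

Lemma dsum_rad2 A B (i j l : 'I_n)
    (ij : nat_of_ord j = i.+1) (jl : nat_of_ord l = j.+1) :
  (dsum_arr A B jl \o dsum_arr A B ij)%VF = 0.
Proof.
apply/lfunP => x; rewrite comp_lfunE !lfunE /= /pair_map /=.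
by rewrite -!comp_lfunE !rep_rad2 !lfunE.
Qed.

Definition rep_dsum A B : rep k n :=
  @Rep k n (fun i => (A i * B i)%type : vectType k)
    (@dsum_arr A B) (@dsum_rad2 A B).

Definition indecomposable M : Prop :=
  ~ rep_zero M /\
  forall A B, rep_iso M (rep_dsum A B) -> rep_zero A \/ rep_zero B.

Definition hom_zero M N : Prop :=
  forall (f : rep_hom M N) (i : 'I_n), f i = 0.

(* Hom(M, M) is isomorphic to k as a vector space; morphisms are compared, and
   linear combinations of them formed, componentwise. *)
Definition end_iso_field M : Prop :=
  exists phi : k -> rep_hom M M,
    [/\ forall (a x y : k) (i : 'I_n),
          phi (a * x + y) i = a *: phi x i + phi y i,
        forall x y : k, (forall i, phi x i = phi y i) -> x = y
      & forall f : rep_hom M M, exists x : k, forall i, phi x i = f i].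

Definition rep_epi M N (f : rep_hom M N) : Prop :=
  forall i, limg (f i) = fullv.

Definition projective P : Prop :=
  forall A B (g : rep_hom A B) (f : rep_hom P B), rep_epi g ->
    exists h : rep_hom P A, forall i, f i = (g i \o h i)%VF.

Definition exact_at A B C (f : rep_hom A B) (g : rep_hom B C) : Prop :=
  forall i, limg (f i) = lker (g i).

Record proj_resolution M := ProjResolution {
  res_ob :> nat -> rep k n;
  res_d : forall p, rep_hom (res_ob p.+1) (res_ob p);
  res_aug : rep_hom (res_ob 0%N) M;
  res_proj : forall p, projective (res_ob p);
  res_epi : rep_epi res_aug;
  res_exact0 : exact_at (res_d 0%N) res_aug;
  res_exact : forall p, exact_at (res_d p.+1) (res_d p) }.

Definition cocycle M N (P : proj_resolution M) (p : nat)
    (f : rep_hom (P p) N) : Prop :=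
  forall i, (f i \o res_d P p i)%VF = 0.

Definition coboundary M N (P : proj_resolution M) (p : nat) :
    rep_hom (P p) N -> Prop :=
  match p with
  | 0%N => fun f => forall i, f i = 0
  | q.+1 => fun f => exists g : rep_hom (P q) N,
      forall i, f i = (g i \o res_d P q i)%VF
  end.

(* Ext^p(M, N) = 0, i.e. the complex Hom(P, N) has no cohomology in degree p.
   The category has enough projectives and the cohomology does not depend on
   the projective resolution P of M. *)
Definition ext_zero (p : nat) M N : Prop :=
  forall (P : proj_resolution M) (f : rep_hom (P p) N),
    cocycle f -> coboundary f.

Definition exceptional M : Prop :=
  [/\ indecomposable M, end_iso_field M
    & forall p, (1 <= p)%N -> ext_zero p M M].

Definition exceptional_pair M N : Prop :=
  [/\ exceptional M, exceptional N, hom_zero N M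
    & forall p, (1 <= p)%N -> ext_zero p N M].

Definition exceptional_seq (t : nat) (M : 'I_t -> rep k n) : Prop :=
  (forall i, exceptional (M i)) /\
  forall i j : 'I_t, (i < j)%N -> exceptional_pair (M i) (M j).

Definition complete_exceptional_seq (M : 'I_n -> rep k n) : Prop :=
  exceptional_seq M.

Definition seq_iso (t : nat) (M N : 'I_t -> rep k n) : Prop :=
  forall i, rep_iso (M i) (N i).

End Category.

(* Up to the equivalence relation E there are exactly c elements of T
   satisfying P. *)
Definition num_classes (T : Type) (P : T -> Prop) (E : T -> T -> Prop)
    (c : nat) : Prop :=
  exists s : 'I_c -> T,
    [/\ forall a, P (s a),
        forall a b, E (s a) (s b) -> a = b
      & forall x, P x -> exists a, E x (s a)].

Definition idempotent_ffuns (n : nat) : {set {ffun 'I_n -> 'I_n}} :=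
  [set f : {ffun 'I_n -> 'I_n} | [forall x, f (f x) == f x]].

Section Forests.
Variable T : finType.
Implicit Types (E : {set {set T}}) (R : {set T}).

Definition simple_graph E : bool := [forall A in E, #|A| == 2].

Definition adj E : rel T := fun x y => [set x; y] \in E.

(* The length of a cycle without repeated vertices is at most #|T|. *)
Definition acyclic E : bool :=
  [forall m : 'I_#|T|.+1, forall c : m.-tuple T,
    (2 < m)%N ==> ~~ ucycleb (adj E) c].

Definition one_root_per_component E R : bool :=
  [forall x, #|[set r in R | connect (adj E) x r]| == 1].

Definition height_le1 E R : bool :=
  [forall x, (x \in R) ||
    [exists r in R, connect (adj E) x r && adj E x r]].

(* A rooted forest is the pair of its edge set and its set of roots. *)
Definition rooted_forests_height_le1 : {set {set {set T}} * {set T}} :=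
  [set F : {set {set T}} * {set T} |
    [&& simple_graph F.1, acyclic F.1, one_root_per_component F.1 F.2
      & height_le1 F.1 F.2]].

End Forests.

(* Main.v *)
(* Indecomposable modules are the simples [S_a] and, for [a + 1 < n], the
   projectives [P_a] with top [S_a] and socle [S_(a+1)]: a nonzero arrow splits
   off some [P_a], and otherwise any nonzero vector splits off some [S_a]. All of
   them are exceptional. Moreover [Hom] is read off the supports, and all [Ext^p],
   [p >= 1], vanish except [Ext^(b - a)(S_a, S_b)] for [a < b]; the vanishing is a
   dimension shift along [0 -> S_(b+1) -> P_b -> S_b -> 0], done on linear forms.

   Hence a complete exceptional sequence is a word of length [n] in the [S_a] and
   [P_a] in which the [S_a] occur in increasing order, [P_(a+1)] and [S_(a+1)]
   occur before [P_a], and [P_a] before [S_a]. Such a word partitions the vertices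
   into intervals [l..r] with a single simple [S_a] each, its letters being, in
   order, [P_(r-1), ..., P_a, S_a, P_(a-1), ..., P_l]. Sending each position to the
   position of the simple in its block is an idempotent function, and it
   determines the word: blocks are ordered as their simples are. *)

From HB Require Import structures.
Require Import Defs.
From mathcomp Require Import all_boot all_order all_algebra.
From mathcomp Require Import zify.

Set Implicit Arguments.
Unset Strict Implicit.
Unset Printing Implicit Defensive.

(** * Exceptional words and idempotent functions *)

Section Words.
Variable n : nat.
Implicit Types (f : {ffun 'I_n -> 'I_n}) (p q : 'I_n) (w : 'I_n -> bool * nat).

(* The letter [(false, a)] stands for the simple module [S_a] and [(true, a)] for
   the projective module [P_a], that is, [(b, a)] for the interval [a..a + b]. *)
Definition pair_ok (o' o : bool * nat) : bool :=
  ~~ [&& o'.2 <= o.2, o.2 <= o'.2 + o'.1 & o'.2 + o'.1 <= o.2 + o.1]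
    && [|| o.1, o'.1 | o'.2 <= o.2].

(** The combinatorial shadow of a complete exceptional sequence: the two conjuncts of [pair_ok]
    encode the vanishing of Hom and of positive Ext from the later module to the earlier one. *)
Definition valid_word w : Prop :=
  (forall q, (w q).2 + (w q).1 < n) /\
  forall p q, p < q -> pair_ok (w p) (w q).

(* The order of the vertices to which the positions correspond. *)
Definition before f : rel 'I_n :=
  fun p q => (f p < f q) || ((f p == f q) && (q < p)).

Definition rank f q : nat := #|[set p | before f p q]|.

(** The vertex of [q] is [rank f q]. Positions after their center have smaller ranks than it and
    carry P at their own vertex. Positions before it have larger ranks and carry P one vertex to the
    left, hence the predecessor. *)
Definition word f q : bool * nat :=
  if f q == q then (false, rank f q)
  else (true, if f q < q then rank f q else (rank f q).-1).

Lemma before_trans f : transitive (before f).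
Proof. by move=> q p r; rewrite /before -!(inj_eq val_inj) /=; lia. Qed.

Lemma before_rank f p q : before f p q -> rank f p < rank f q.
Proof.
move=> pq; apply/proper_card/properP; split.
  by apply/subsetP=> r; rewrite !inE => /before_trans; apply.
by exists p; rewrite !inE // /before !ltnn andbF.
Qed.

Lemma rank_bound f q : rank f q < n.
Proof.
rewrite -[X in _ < X](card_ord n) -cardsT; apply/proper_card/properP; split=> //.
by exists q; rewrite !inE // /before !ltnn andbF.
Qed.

Lemma rank_fiber f p q : f p < f q -> rank f p < rank f q.
Proof. by move=> fpq; apply: before_rank; rewrite /before fpq. Qed.

Lemma rank_in_fiber f p q : f p = f q -> q < p -> rank f p < rank f q.
Proof. by move=> fpq qp; apply: before_rank; rewrite /before fpq eqxx qp orbT. Qed.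

Lemma idempotentP f : reflect (forall q, f (f q) = f q) (f \in idempotent_ffuns n).
Proof. by rewrite inE; apply: (iffP forallP) => + q => /(_ q) => [/eqP|/eqP]. Qed.

Lemma word_valid f : f \in idempotent_ffuns n -> valid_word (word f).
Proof.
move=> /idempotentP ff; split=> [q|p q pq].
  rewrite /word; case: eqP => [_|/eqP]; first by rewrite addn0 rank_bound.
  rewrite -(inj_eq val_inj) /= => nq.
  have := rank_bound f q; have := rank_bound f (f q).
  have := @rank_in_fiber f q (f q) (esym (ff q)).
  have := @rank_in_fiber f (f q) q (ff q).
  by case: (ltnP (f q) q) => ? /=; lia.
(* All comparisons between the ranks of [p], [q], [f p] and [f q] are collected, so that the four
   cases become linear arithmetic. *)
have := @rank_in_fiber f q (f q) (esym (ff q)).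
have := @rank_in_fiber f (f q) q (ff q).
have := @rank_in_fiber f p (f p) (esym (ff p)).
have := @rank_in_fiber f (f p) p (ff p).
have := @rank_fiber f p q; have := @rank_fiber f q p.
have := @rank_fiber f (f p) q; have := @rank_fiber f q (f p).
have := @rank_fiber f p (f q); have := @rank_fiber f (f q) p.
have := @rank_fiber f (f p) (f q); have := @rank_fiber f (f q) (f p).
rewrite !ff.
have : f p = f q :> nat -> rank f q < rank f p /\ rank f (f p) = rank f (f q).
  by move=> /val_inj e; split; [apply: rank_in_fiber | rewrite e].
rewrite /pair_ok /word -!(inj_eq val_inj) /=.
case: (eqVneq (f p : nat) p) => e1; case: (eqVneq (f q : nat) q) => e2 /=.
- by rewrite ?e1 ?e2; lia.
- case: (ltnP (f q) q) => ? /=; lia.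
- case: (ltnP (f p) p) => ? /=; lia.
- case: (ltnP (f q) q) => ?; case: (ltnP (f p) p) => ? /=; lia.
Qed.

(* [center w q c]: the simple module at position [c] is the one in the block of the
   letter at position [q]; for a letter [P_j] it is either the last [S_b] with
   [b <= j], if that comes later, or the first [S_b] with [j < b], if that comes
   earlier. *)
Definition center w q c : Prop :=
  (w c).1 = false /\
  if (w q).1 then
    ((w c).2 <= (w q).2 /\ q < c /\
       forall r, (w r).1 = false -> (w r).2 <= (w q).2 -> r <= c) \/
    ((w q).2 < (w c).2 /\ c < q /\
       forall r, (w r).1 = false -> (w q).2 < (w r).2 -> c <= r)
  else c = q.

(** Simples occur in increasing order, so the two alternatives for a letter P_j exclude each other;
    within one alternative both positions are extremal. *)
Lemma center_inj w q c c' :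
  valid_word w -> center w q c -> center w q c' -> c = c'.
Proof.
move=> [_ vw] [Sc hc] [Sc' hc']; case: (w q).1 hc hc' => [|-> -> //].
have := vw c c'; have := vw c' c; rewrite /pair_ok Sc Sc' /= => cc' c'c.
move=> [[h1 [h2 h3]]|[h1 [h2 h3]]] [[g1 [g2 g3]]|[g1 [g2 g3]]]; apply/val_inj => /=.
- have := h3 _ Sc' g1; have := g3 _ Sc h1; lia.
- lia.
- lia.
- have := h3 _ Sc' g1; have := g3 _ Sc h1; lia.
Qed.

(** This recovers [f] from its word. The simples sit at the fixed points, and fixed points before or
    after [f q] have ranks below or above that of [q], which makes [f q] extremal. *)
Lemma word_center f q : f \in idempotent_ffuns n -> center (word f) q (f q).
Proof.
move=> /idempotentP ff.
have wr r : (word f r).1 = false -> f r = r /\ (word f r).2 = rank f r.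
  by rewrite /word; case: eqP.
have wf : word f (f q) = (false, rank f (f q)) by rewrite /word ff eqxx.
rewrite /center wf; split=> //.
have [e|nq] := eqVneq (f q) q; first by rewrite {1}/word e eqxx.
have -> : word f q = (true, if f q < q then rank f q else (rank f q).-1).
  by rewrite /word (negPf nq).
move: nq; rewrite -(inj_eq val_inj) /=; case: (ltnP (f q) q) => fq /eqP nq.
  right; split; first by apply: rank_in_fiber; rewrite ?ff.
  split=> // r /wr[fr ->] hr; rewrite leqNgt; apply/negP => rq.
  by have := @rank_fiber f r q; rewrite fr; lia.
left; have := @rank_in_fiber f (f q) q (ff q); split; first lia.
split; first lia.
move=> r /wr[fr ->] hr; rewrite leqNgt; apply/negP => rq.
by have := @rank_fiber f q r; rewrite fr; lia.
Qed.

Lemma word_inj f f' : f \in idempotent_ffuns n -> f' \in idempotent_ffuns n ->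
  word f =1 word f' -> f = f'.
Proof.
move=> If If' eqw; apply/ffunP => q.
apply: (center_inj (word_valid If)); first exact: word_center.
have := word_center q If'; rewrite /center !eqw.
case: (word f' q).1 => // -[? h]; split=> //.
by case: h => -[? [? h]]; [left|right]; do 2!split=> //; move=> r; rewrite eqw; apply: h.
Qed.

(** * From valid words back to idempotent functions *)

Section Surjectivity.
Variable w : 'I_n -> bool * nat.
Hypothesis vw : valid_word w.

(** For a letter P_j this decides whether its center comes later: it is the first alternative of
    [center] without extremality. *)
Definition centered_after q : bool :=
  [exists c : 'I_n, [&& ~~ (w c).1, (w c).2 <= (w q).2 & q < c]].

(* A block has as many letters as vertices; this matches them up. Completeness of the
   sequence only enters through the surjectivity of this injective map. *)
Definition vertex q : nat := (w q).2 + ((w q).1 && centered_after q).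

Lemma vertex_bound q : vertex q < n.
Proof. by have := vw.1 q; rewrite /vertex; case: (w q).1; case: (centered_after q) => /=; lia. Qed.

(** Once a projective letter is involved, [pair_ok] leaves one possible collision for each pair of
    kinds. There the simple after [q], or [q] itself, would center [p] later as well, or the simples
    would be out of order. *)
Lemma vertex_lt_neq p q : p < q -> vertex p <> vertex q.
Proof.
move=> pq; have := vw.2 _ _ pq; rewrite /pair_ok /vertex.
case E: (w p).1; case E': (w q).1 => /=; [| | |lia].
- have [/existsP[c /and3P[Sc hc pc]]|hp] := boolP (centered_after p);
  have [/existsP[d /and3P[Sd hd qd]]|hq] := boolP (centered_after q);
  rewrite /= ?hp; try lia.
  move=> h1 h2; case/existsP: hp; exists d; apply/and3P; split=> //; lia.
- have [/existsP[c /and3P[Sc hc pc]]|hp] := boolP (centered_after p); rewrite /=; first lia.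
  move=> h1 h2; case/existsP: hp; exists q; rewrite E' /=; lia.
- have [/existsP[c /and3P[Sc hc qc]]|hp] := boolP (centered_after q); rewrite /=; last lia.
  move=> h1 h2; have := vw.2 p c (ltn_trans pq qc).
  rewrite /pair_ok E (negPf Sc) /=; lia.
Qed.

Lemma vertex_inj : injective vertex.
Proof.
move=> p q e; apply: val_inj.
by case: (ltngtP (val p) (val q)) => // /vertex_lt_neq; case.
Qed.

Definition vertex_ord q : 'I_n := Ordinal (vertex_bound q).

Lemma vertex_ord_inj : injective vertex_ord.
Proof. by move=> p q [] /vertex_inj. Qed.

Lemma vertex_surj x : x < n -> exists q, vertex q = x.
Proof.
move=> xn; have [g _ gK] := injF_bij vertex_ord_inj.
by exists (g (Ordinal xn)); have := gK (Ordinal xn) => /(congr1 val).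
Qed.

Lemma word_pos_inj p q : w p = w q -> p = q.
Proof.
move=> e; apply: val_inj.
by case: (ltngtP (val p) (val q)) => // /vw.2; rewrite /pair_ok e; case: (w q).1 => /=; lia.
Qed.

(** Induction from the last vertex downwards. For [w q] = P_j, some letter has vertex j+1. It is
    either S_(j+1), which must precede P_j, or P_(j+1) not centered later, which also precedes P_j
    and to which the induction applies. *)
Lemma center_before q : (w q).1 -> ~~ centered_after q ->
  exists c : 'I_n, [&& ~~ (w c).1, (w q).2 < (w c).2 & c < q].
Proof.
have [m] := ubnP (n - (w q).2); elim: m q => // m IHm q hm Pq nq.
have b := vw.1 q; rewrite Pq in b.
have [r hr] : exists r, vertex r = (w q).2.+1 by apply: vertex_surj; lia.
move: hr; rewrite /vertex; case Pr: (w r).1 => /=.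
  case cr: (centered_after r) => /= hr.
    suff rq : r = q by move: nq; rewrite -rq cr.
    apply: word_pos_inj; move: Pr Pq hr; case: (w r) => ? ?; case: (w q) => ? ? /= -> ->.
    by rewrite addn1 => -[->].
  have /IHm : n - (w r).2 < m by lia.
  rewrite cr Pr => /(_ isT isT) [c /and3P[Sc h1 h2]].
  exists c; rewrite Sc; have rq : ~~ (q < r).
    apply/negP => /vw.2; rewrite /pair_ok Pr Pq /=; lia.
  rewrite -leqNgt in rq; lia.
rewrite addn0 => hr; exists r; rewrite Pr hr ltnSn /=.
case: (ltngtP r q) => // [qr|/val_inj rq]; last by rewrite rq Pq in Pr.
have := vw.2 _ _ qr; rewrite /pair_ok Pr Pq hr /=; lia.
Qed.

Lemma center_exists q : exists c, center w q c.
Proof.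
rewrite /center; case Pq: (w q).1; last by exists q.
case: (boolP (centered_after q)) => [/existsP[c0 /and3P[Sc0 h1 h2]]|].
  pose P := [pred c : 'I_n | ~~ (w c).1 & (w c).2 <= (w q).2].
  have Pc0 : P c0 by rewrite /= Sc0.
  case: (arg_maxnP (fun c : 'I_n => val c) Pc0) => c /andP[/negbTE Sc hc] cmax.
  exists c; split=> //; left; do 2!split=> //; first by apply: leq_trans h2 (cmax _ Pc0).
  by move=> r Sr hr; apply: cmax; rewrite /= Sr.
move=> /(center_before Pq)[c0 /and3P[Sc0 h1 h2]].
pose P := [pred c : 'I_n | ~~ (w c).1 & (w q).2 < (w c).2].
have Pc0 : P c0 by rewrite /= Sc0.
case: (arg_minnP (fun c : 'I_n => val c) Pc0) => c /andP[/negbTE Sc hc] cmin.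
exists c; split=> //; right; do 2!split=> //; first by apply: leq_ltn_trans (cmin _ Pc0) h2.
by move=> r Sr hr; apply: cmin; rewrite /= Sr.
Qed.

Lemma simple_order p q : (w p).1 = false -> (w q).1 = false ->
  (p < q) = ((w p).2 < (w q).2).
Proof.
move=> Sp Sq; have := vw.2 p q; have := vw.2 q p; rewrite /pair_ok Sp Sq /=.
by case: (ltngtP (val p) (val q)) => [||/val_inj ->]; lia.
Qed.

Lemma center_spec q c : center w q c -> (w c).1 = false /\
  [\/ [/\ (w q).1 = false, c = q & vertex q = (w q).2],
      [/\ (w q).1, vertex q = (w q).2.+1, (w c).2 <= (w q).2, q < c
        & forall r, (w r).1 = false -> (w r).2 <= (w q).2 -> r <= c]
    | [/\ (w q).1, vertex q = (w q).2, (w q).2 < (w c).2, c < q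
        & forall r, (w r).1 = false -> (w q).2 < (w r).2 -> c <= r]].
Proof.
rewrite /vertex => -[Sc hc]; split=> //.
case: (w q).1 hc => [|->]; last by constructor 1; rewrite addn0.
case=> -[h1 [h2 h3]]; [constructor 2|constructor 3]; split=> //=.
  suff -> : centered_after q by rewrite addn1.
  by apply/existsP; exists c; rewrite Sc h1 h2.
(* A simple after [q] with index at most that of [w q] would be out of order with the simple at
   [c]. *)
have [/existsP [r /and3P[/negbTE Sr hr qr]]|_] := boolP (centered_after q); last by rewrite addn0.
by have := simple_order Sc Sr; lia.
Qed.

(** This is the relation [before] for neighboring vertices; transitivity extends it to all pairs. *)
Lemma center_step p q c d : center w p c -> center w q d ->
  (vertex p).+1 = vertex q -> c < d \/ (c = d :> nat /\ q < p).
Proof.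
have vS r : (w r).1 = false -> vertex r = (w r).2 by rewrite /vertex => ->; rewrite addn0.
have hpq := vw.2 p q; have hqp := vw.2 q p.
have vpq : p = q :> nat -> vertex p = vertex q by move=> /val_inj ->.
move=> /center_spec[Sc cp] /center_spec[Sd dq] e.
have cd := simple_order Sc Sd.
have dc := simple_order Sd Sc.
(* A simple S_b has vertex b, so injectivity of [vertex] keeps the indices of the centers apart from
   the vertices of projective letters. *)
have vc : (w p).1 -> (w c).2 <> vertex p.
  by move=> Pp; rewrite -(vS _ Sc) => /vertex_inj cE; rewrite -cE Sc in Pp.
have vc' : (w q).1 -> (w c).2 <> vertex q.
  by move=> Pp; rewrite -(vS _ Sc) => /vertex_inj cE; rewrite -cE Sc in Pp.
have vd : (w p).1 -> (w d).2 <> vertex p.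
  by move=> Pp; rewrite -(vS _ Sd) => /vertex_inj cE; rewrite -cE Sd in Pp.
have vd' : (w q).1 -> (w d).2 <> vertex q.
  by move=> Pp; rewrite -(vS _ Sd) => /vertex_inj cE; rewrite -cE Sd in Pp.
move: hpq hqp; rewrite /pair_ok.
case: cp => [[Tp h1 h2]|[Tp h1 h2 h3 h4]|[Tp h1 h2 h3 h4]];
case: dq => [[Tq g1 g2]|[Tq g1 g2 g3 g4]|[Tq g1 g2 g3 g4]]; rewrite Tp Tq /=;
  try (have := h4 _ Sc; have := h4 _ Sd); try (have := g4 _ Sc; have := g4 _ Sd);
  try subst c; try subst d; lia.
Qed.

End Surjectivity.

Lemma word_surj w : valid_word w ->
  exists2 f, f \in idempotent_ffuns n & word f =1 w.
Proof.
move=> vw; have [F cF] := fin_all_exists (center_exists vw).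
pose f := [ffun q => F q].
have cf q : center w q (f q) by rewrite ffunE.
have step p q : (vertex w p).+1 = vertex w q -> before f p q.
  move=> /(center_step vw (cf p) (cf q)); rewrite /before -!(inj_eq val_inj) /=; lia.
(* Induction through the letter at the preceding vertex, which exists because [vertex] is onto. *)
have mono p q : vertex w p < vertex w q -> before f p q.
  have [m] := ubnP (vertex w q); elim: m q => // m IHm q hm pq.
  have [e|ne] := eqVneq (vertex w p).+1 (vertex w q); first exact: step.
  have [r hr] : exists r, vertex w r = (vertex w q).-1.
    by apply: (vertex_surj vw); have := vertex_bound vw q; lia.
  by apply: (before_trans (y := r)); [apply: IHm; lia | apply: step; lia].
have rankE q : rank f q = vertex w q.
  (* The positions before [q] correspond bijectively to the vertices below that of [q]. *)
  rewrite /rank; have -> : [set p | before f p q] =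
      (vertex_ord vw) @^-1: [set x : 'I_n | x < vertex w q].
    apply/setP => p; rewrite !inE /=; apply/idP/idP => [pq|/mono //].
    case: (ltngtP (vertex w p) (vertex w q)) => // [/mono qp|/(vertex_inj vw) e].
      by have := before_trans pq qp; rewrite /before !ltnn andbF.
    by move: pq; rewrite e /before !ltnn andbF.
  rewrite on_card_preimset; last first.
    have [g gK Kg] := injF_bij (@vertex_ord_inj w vw).
    by exists g => x _; [apply: gK | apply: Kg].
  rewrite -sum1dep_card -(big_ord_widen n (fun=> 1)) ?sum1_card ?card_ord //.
  exact/ltnW/vertex_bound.
exists f => [|q].
  (* A center carries a simple, and a simple is its own center. *)
  apply/idempotentP => q; apply: (center_inj vw (cf (f q))).
  by have [Sc _] := cf q; split; rewrite ?Sc.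
rewrite /word rankE; case: (center_spec vw (cf q)) => Sc [[Tq -> ->]|[Tq -> _ lt _]|[Tq -> _ lt _]].
- by rewrite eqxx; case: (w q) Tq => ? ? /= ->.
- rewrite -(inj_eq val_inj) /= gtn_eqF // ltnNge (ltnW lt) /=.
  by case: (w q) Tq => ? ? /= ->.
- by rewrite -(inj_eq val_inj) /= ltn_eqF // lt; case: (w q) Tq => ? ? /= ->.
Qed.

End Words.

(** * Rooted forests of height at most one *)

Section Forests.
Variable T : finType.
Implicit Types (f : {ffun T -> T}) (E : {set {set T}}) (R : {set T}).

Lemma adjC E x y : adj E x y = adj E y x.
Proof. by rewrite /adj setUC. Qed.

Definition star_forest f : {set {set T}} * {set T} :=
  ([set [set x; f x] | x in [set x | f x != x]], [set x | f x == x]).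

Lemma set2_eq (a b c d : T) :
  [set a; b] = [set c; d] -> a = c /\ b = d \/ a = d /\ b = c.
Proof.
move=> e.
have : a \in [set c; d] by rewrite -e set21.
have : b \in [set c; d] by rewrite -e set22.
have : c \in [set a; b] by rewrite e set21.
have : d \in [set a; b] by rewrite e set22.
rewrite !inE => /orP[]/eqP-> /orP[]/eqP-> /orP[]/eqP h /orP[]/eqP h'; subst; auto.
Qed.

Lemma adj_star f x y :
  reflect (x <> y /\ (y = f x \/ x = f y)) (adj (star_forest f).1 x y).
Proof.
apply: (iffP imsetP) => [[z]|[xy [e|e]]].
- by rewrite inE => /eqP nz /set2_eq[[-> ->]|[-> ->]]; split; auto=> /esym.
- by exists x; rewrite ?inE -?e // eq_sym; apply/eqP.
- by exists y; rewrite ?inE -?e 1?setUC //; apply/eqP.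
Qed.

Section Idempotent.
Variable f : {ffun T -> T}.
Hypothesis ff : forall x, f (f x) = f x.

Lemma adj_star_leaf x y : f x <> x -> adj (star_forest f).1 x y -> y = f x.
Proof. by move=> nx /adj_star[_ [//|e]]; case: nx; rewrite e ff. Qed.

Lemma connect_star x y : connect (adj (star_forest f).1) x y -> f x = f y.
Proof.
case/connectP => s; elim: s x => [|z s IHs] x /=; first by move=> _ ->.
move=> /andP[/adj_star[_ [e|e]] /IHs h /h <-]; by rewrite e ff.
Qed.

(** A point that is not fixed has its image as only neighbor, and of two adjacent points one is not
    fixed; on a cycle every point would have two distinct neighbors. *)
Lemma star_acyclic : acyclic (star_forest f).1.
Proof.
apply/forallP => m; apply/forallP => -[c /= /eqP sc]; apply/implyP => m2.
case: c sc => [|x [|y [|z s]]] /= sc; try by move: m2; rewrite -sc.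
apply/negP => /andP[/= /and3P[xy yz pz] /and3P[]].
rewrite !inE !negb_or => /and3P[nxy nxz nxs] /andP[nyz nys] _.
have [fy|/eqP ny] := eqVneq (f y) y; last first.
  move: xy; rewrite adjC => /(adj_star_leaf ny) ex.
  by move: nxz; rewrite ex -(adj_star_leaf ny yz) eqxx.
have nx : f x <> x.
  move=> fx; case/adj_star: xy => /eqP; rewrite (negPf nxy) // => _ [e|e].
    by rewrite e fx eqxx in nxy.
  by rewrite e fy eqxx in nxy.
move: pz; rewrite rcons_path => /andP[_]; rewrite adjC => /(adj_star_leaf nx) e.
have := mem_last z s; rewrite e -(adj_star_leaf nx xy) inE (negPf nyz) /=.
by rewrite (negPf nys).
Qed.

Lemma star_forestP : star_forest f \in rooted_forests_height_le1 T.
Proof.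
have conn x : connect (adj (star_forest f).1) x (f x).
  have [->|nx] := eqVneq (f x) x; first exact: connect0.
  apply/connect1/adj_star; split; last by left.
  by move=> e; rewrite -e eqxx in nx.
rewrite inE star_acyclic /=; apply/and3P; split.
- apply/forallP => A; apply/implyP => /imsetP[x]; rewrite inE => nx ->.
  by rewrite cards2 [x == _]eq_sym nx.
- apply/forallP => x; apply/cards1P; exists (f x); apply/setP => r.
  rewrite !inE; apply/andP/eqP => [[/eqP fr /connect_star ->] //|->].
  by rewrite ff eqxx conn.
- apply/forallP => x; rewrite inE; case: eqVneq => //= nx.
  apply/existsP; exists (f x); rewrite inE ff eqxx conn /=.
  by apply/adj_star; split; [move=> e; rewrite -e eqxx in nx | left].
Qed.

End Idempotent.

Lemma star_forest_inj f f' :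
  (forall x, f (f x) = f x) -> (forall x, f' (f' x) = f' x) ->
  star_forest f = star_forest f' -> f = f'.
Proof.
move=> ff ff' e; apply/ffunP => x.
have fix_eq y : (f y == y) = (f' y == y).
  by have /setP/(_ y) := congr1 snd e; rewrite !inE.
have [fx|nx] := eqVneq (f x) x.
  by rewrite fx; apply/esym/eqP; rewrite -fix_eq fx.
apply: (@adj_star_leaf f' ff' x).
  by apply/eqP; rewrite -fix_eq.
by rewrite -e; apply/adj_star; split; [apply/nesym/eqP | left].
Qed.

(** The function sends each vertex to the root of its component. *)
Lemma star_forest_surj E R : (E, R) \in rooted_forests_height_le1 T ->
  exists2 f : {ffun T -> T}, (forall x, f (f x) = f x) & star_forest f = (E, R).
Proof.
rewrite inE => /and4P[/= /forallP sE /forallP aE /forallP oE /forallP hE].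
(* The default [x] only makes the expression total: every component has a root to pick. *)
pose f := [ffun x => odflt x [pick r in R | connect (adj E) x r]].
have fP x r : r \in R -> connect (adj E) x r -> r = f x.
  move=> rR xr; rewrite ffunE; have /cards1P[r0 /setP e] := oE x.
  have : r \in [set r0] by rewrite -e inE rR.
  case: pickP => [r' /andP[rR' xr']|/(_ r)]; last by rewrite rR xr.
  have : r' \in [set r0] by rewrite -e inE rR'.
  by rewrite !inE => /eqP -> /eqP ->.
have fx x : f x \in R /\ connect (adj E) x (f x).
  have /cards1P[r /setP e] := oE x.
  have : r \in [set r] by rewrite inE.
  by rewrite -e inE => /andP[rR xr]; rewrite -(fP x r).
have fR x : x \in R -> f x = x by move=> xR; rewrite -(fP x x) ?connect0.
have Rf x : (f x == x) = (x \in R).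
  by apply/eqP/idP => [<-|/fR //]; case: (fx x).
have xfx x : x \notin R -> adj E x (f x).
  move=> nR; have := hE x; rewrite (negPf nR) /= => /existsP[r /and3P[rR xr a]].
  by rewrite -(fP x r).
have adjf x y : adj E x y -> f x = f y.
  move=> a; have [fyR yfy] := fx y; rewrite -(fP x (f y)) //.
  exact: connect_trans (connect1 a) yfy.
exists f => [x|]; first by apply: fR; case: (fx x).
congr (_, _); last by apply/setP => x; rewrite inE Rf.
apply/setP => A; apply/imsetP/idP => [[x]|AE].
  by rewrite inE Rf => /xfx a ->.
have := sE A; rewrite AE => /cards2P[x [y [xy eA]]].
have axy : adj E x y by rewrite /adj -eA.
have fxy := adjf _ _ axy.
have [xR|nx] := boolP (x \in R).
  exists y; last by rewrite eA -fxy (fR x) // setUC.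
  by rewrite inE -fxy (fR x).
have [yR|ny] := boolP (y \in R).
  by exists x; rewrite ?inE fxy (fR y) // eq_sym.
(* With neither end a root, both are adjacent to their common root, and the triangle contradicts
   acyclicity. *)
have r := xfx _ nx; have := xfx _ ny; rewrite -fxy => r'.
have nxr : x != f x by rewrite eq_sym Rf.
have nyr : y != f x by rewrite fxy eq_sym Rf.
have u : uniq [:: x; y; f x] by rewrite /= !inE negb_or xy nxr nyr.
have le3 : 3 < #|T|.+1.
  by rewrite ltnS -(card_uniqP u : _ = 3) max_card.
have /forallP/(_ [tuple x; y; f x]) := aE (Ordinal le3).
by rewrite /= /ucycleb u andbT /= axy r' andbT adjC r.
Qed.

End Forests.

Import GRing.Theory.
Local Open Scope ring_scope.

(** * Interval modules *)

Section Intervals.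
Variables (k : fieldType) (n : nat).
Implicit Types (M N : rep k n) (o : bool * nat) (d : bool).

Lemma arrow_irrelevance M (i j : 'I_n) (e e' : nat_of_ord j = i.+1) :
  rep_arr M e = rep_arr M e'.
Proof. by rewrite (eq_irrelevance e e'). Qed.

Lemma arrow_arrow M (i j l : 'I_n) (e : nat_of_ord j = i.+1)
    (e' : nat_of_ord l = j.+1) x : rep_arr M e' (rep_arr M e x) = 0.
Proof. by rewrite -comp_lfunE rep_rad2 lfunE. Qed.

Lemma rep_hom_arr M N (f : rep_hom M N) (i j : 'I_n) (e : nat_of_ord j = i.+1) x :
  f j (rep_arr M e x) = rep_arr N e (f i x).
Proof. by have /lfunP/(_ x) := rep_mapP f e; rewrite !comp_lfunE. Qed.

Lemma rep_hom_of M N (F : forall v, M v -> N v) : (forall v, linear (F v)) ->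
  (forall (i j : 'I_n) (e : nat_of_ord j = i.+1) x,
     F j (rep_arr M e x) = rep_arr N e (F i x)) ->
  exists h : rep_hom M N, forall v x, h v x = F v x.
Proof.
move=> linF arrF.
pose L v : {linear M v -> N v} :=
  HB.pack_for {linear M v -> N v} (F v) (GRing.isLinear.Build _ _ _ _ (F v) (linF v)).
have LE v x : linfun (L v) x = F v x by rewrite lfunE.
have h (i j : 'I_n) (e : nat_of_ord j = i.+1) :
    (linfun (L j) \o rep_arr M e)%VF = (rep_arr N e \o linfun (L i))%VF.
  by apply/lfunP => x; rewrite !comp_lfunE !LE arrF.
by exists (RepHom h).
Qed.

Lemma rep_hom_comp M N L (f : rep_hom M N) (g : rep_hom N L) :
  exists h : rep_hom M L, forall v x, h v x = g v (f v x).
Proof.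
apply: rep_hom_of => [v a x y|i j e x]; first by rewrite !linearP.
by rewrite !rep_hom_arr.
Qed.

(** Interval modules live on at most two vertices, so morphisms from or to them are prescribed by
    two values. *)
Lemma family_at (T : 'I_n -> Type) (T0 : forall v, T v) (a b : 'I_n) (x : T a) (y : T b) :
  b <> a -> exists m : forall v, T v, m a = x /\ m b = y.
Proof.
move=> ab; exists (dfwith (dfwith T0 y) x); rewrite dfwith_in; split=> //.
by rewrite dfwith_out ?dfwith_in //; apply/eqP => /esym.
Qed.

(** The spaces of an interval module are ['rV_d] with [d] a Boolean read as 0 or 1; [tot] is the
    coordinate or zero, without a case distinction. *)
Definition tot d (r : 'rV[k]_d) : k := \sum_i r 0 i.

Lemma tot_is_linear d : linear (@tot d : _ -> k^o).
Proof.
move=> a r s; rewrite /tot scaler_sumr -big_split /=.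
by apply: eq_bigr => i _; rewrite !mxE.
Qed.

HB.instance Definition _ d :=
  GRing.isLinear.Build k 'rV[k]_d k^o _ (@tot d) (@tot_is_linear d).

Definition tot_lfun d : 'Hom('rV[k]_d, k^o) := linfun (@tot d : 'rV[k]_d -> k^o).

Lemma tot_lfunE d r : tot_lfun d r = tot r.
Proof. by rewrite lfunE. Qed.

Lemma tot_const d c : tot (const_mx c : 'rV_d) = c *+ d.
Proof. by rewrite /tot (eq_bigr (fun=> c)) => [|i _]; rewrite ?mxE // sumr_const card_ord. Qed.

Lemma tot0 d : tot (0 : 'rV_d) = 0.
Proof. by rewrite tot_const mul0rn. Qed.

Lemma const_tot d (r : 'rV_d) : const_mx (tot r) = r.
Proof.
apply/rowP => i; rewrite mxE /tot; case: d r i => [r i|r [] //].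
by rewrite (big_ord1 _ (fun j : 'I_1 => r 0 j)) (ord1 (i : 'I_1)).
Qed.

Lemma row_eq0 d (r : 'rV[k]_d) : ~~ d -> r = 0.
Proof. by case: d r => // r _; apply: thinmx0. Qed.

(** The identity of [k] if both dimensions are one, and zero otherwise. *)
Definition spread d d' (r : 'rV[k]_d) : 'rV[k]_d' := const_mx (tot r).

Lemma spread_is_linear d d' : linear (@spread d d').
Proof. by move=> a r s; rewrite /spread linearP; apply/rowP => i; rewrite !mxE. Qed.

HB.instance Definition _ d d' :=
  GRing.isLinear.Build k 'rV[k]_d 'rV[k]_d' _ (@spread d d') (@spread_is_linear d d').

Definition supp o (v : nat) : bool := (o.2 <= v <= o.2 + o.1)%N.

Lemma interval_rad2 o (i j l : 'I_n) (ij : nat_of_ord j = i.+1) (jl : nat_of_ord l = j.+1) :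
  (linfun (@spread (supp o j) (supp o l)) \o linfun (@spread (supp o i) (supp o j)))%VF = 0.
Proof.
apply/lfunP => r; rewrite comp_lfunE !lfunE /=.
have /orP[si|si] := orbN (supp o i); last by rewrite (row_eq0 r si) !linear0.
apply: row_eq0; move: si; rewrite /supp jl ij; case: (o.1) => /=; lia.
Qed.

(* [interval_rep (false, a)] is the simple module at [a] and [interval_rep (true, a)] the
   indecomposable projective module with top [a]; the latter is simple if [a] is
   the last vertex, and zero if [a >= n]. *)
Definition interval_rep o : rep k n :=
  @Rep k n (fun v => 'rV[k]_(supp o v)) (fun i j _ => linfun (@spread _ _)) (@interval_rad2 o).

Lemma interval_arr o (i j : 'I_n) (e : nat_of_ord j = i.+1) r :
  rep_arr (interval_rep o) e r = const_mx (tot r).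
Proof. by rewrite lfunE. Qed.

Lemma hom_from_interval o M (m : forall v, M v) :
  (forall (i j : 'I_n) (e : nat_of_ord j = i.+1), supp o i ->
     rep_arr M e (m i) = m j *+ supp o j) ->
  exists h : rep_hom (interval_rep o) M, forall v r, h v r = tot r *: m v.
Proof.
move=> hm; apply: rep_hom_of => [v a r s|i j e r].
  by rewrite linearP scalerDl scalerA.
rewrite interval_arr tot_const linearZ /=.
have /orP[si|si] := orbN (supp o i); first by rewrite hm // -scalerMnr scalerMnl.
by rewrite (row_eq0 r si) linear0 mul0rn !scale0r.
Qed.

Lemma hom_to_interval o M (phi : forall v, 'Hom(M v, k^o)) :
  (forall (i j : 'I_n) (e : nat_of_ord j = i.+1) x, supp o j ->
     phi j (rep_arr M e x) = phi i x *+ supp o i) ->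
  exists h : rep_hom M (interval_rep o), forall v x, h v x = const_mx (phi v x).
Proof.
move=> hphi; apply: rep_hom_of => [v a r s|i j e r].
  by rewrite linearP; apply/rowP => i; rewrite !mxE.
rewrite interval_arr tot_const.
have /orP[sj|sj] := orbN (supp o j); first by rewrite hphi.
by rewrite [LHS]row_eq0 // [RHS]row_eq0.
Qed.

(** In the square over an arrow, the two composites from [o] at [v] to [o'] at [v.+1] pass through
    [o'] at [v] and through [o] at [v.+1]; they agree if both or neither of these spaces vanish. *)
Definition spreadable o o' : Prop :=
  forall v : nat, supp o v -> supp o' v.+1 -> supp o' v = supp o v.+1.

Lemma spread_arr o o' (i j : 'I_n) (e : nat_of_ord j = i.+1) : spreadable o o' ->
  (linfun (@spread (supp o j) (supp o' j)) \o rep_arr (interval_rep o) e =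
   rep_arr (interval_rep o') e \o linfun (@spread (supp o i) (supp o' i)))%VF.
Proof.
move=> hs; apply/lfunP => r; rewrite !comp_lfunE !interval_arr !lfunE /= /spread !tot_const.
have /orP[si|si] := orbN (supp o i); last first.
  by rewrite (row_eq0 r si) linear0 !mul0rn.
have /orP[sj|sj] := orbN (supp o' j); last by rewrite [LHS]row_eq0 // [RHS]row_eq0.
by have -> : supp o j = supp o' i by rewrite e -(hs i) // -e.
Qed.

Definition spread_hom o o' (h : spreadable o o') :
    rep_hom (interval_rep o) (interval_rep o') :=
  @RepHom k n (interval_rep o) (interval_rep o')
    (fun v => linfun (@spread (supp o v) (supp o' v))) (fun i j e => spread_arr e h).

Lemma spread_homE o o' (h : spreadable o o') v r :
  spread_hom h v r = const_mx (tot r).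
Proof. by rewrite lfunE. Qed.

End Intervals.

(** * Morphisms between interval modules *)

Section Homs.
Variables (k : fieldType) (n : nat).
Implicit Types (M N : rep k n) (o : bool * nat) (d : bool).

Lemma rep_zeroP M : rep_zero M <-> forall v (x : M v), x = 0.
Proof.
split=> [zM v x|zM v].
  by apply/eqP; rewrite -memv0 -(_ : fullv = 0%VS) ?memvf //; apply/eqP; rewrite -dimv_eq0 zM.
apply/eqP; rewrite dimv_eq0 -subv0; apply/subvP => x _.
by rewrite (zM v x) mem0v.
Qed.

Definition gen o (v : 'I_n) : interval_rep k n o v := const_mx 1.

Lemma interval_scale_gen o (v : 'I_n) (r : interval_rep k n o v) : r = tot r *: gen o v.
Proof. by rewrite -[LHS]const_tot; apply/rowP => i; rewrite !mxE mulr1. Qed.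

Lemma tot_supp o (v : nat) (c : k) : supp o v -> tot (const_mx c : 'rV_(supp o v)) = c.
Proof. by rewrite tot_const => ->. Qed.

Lemma gen_scale_inj o (v : 'I_n) (x y : k) :
  supp o v -> x *: gen o v = y *: gen o v -> x = y.
Proof.
move=> sv; have scaleE z : z *: gen o v = const_mx z by apply/rowP => i; rewrite !mxE mulr1.
by rewrite !scaleE => /(congr1 (@tot k _)); rewrite !tot_supp.
Qed.

Lemma interval_arr_inj o (i j : 'I_n) (e : nat_of_ord j = i.+1) (r s : interval_rep k n o i) :
  supp o j -> rep_arr (interval_rep k n o) e r = rep_arr (interval_rep k n o) e s -> r = s.
Proof.
move=> sj; rewrite !interval_arr => /(congr1 (@tot k _)).
by rewrite !tot_supp // => h; rewrite -[r]const_tot h const_tot.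
Qed.

Lemma interval_arr_surj o (i j : 'I_n) (e : nat_of_ord j = i.+1) (r : interval_rep k n o j) :
  supp o i -> exists s, r = rep_arr (interval_rep k n o) e s.
Proof.
move=> si; exists (const_mx (tot r)).
by rewrite interval_arr tot_supp // const_tot.
Qed.

Lemma gen_neq0 o (v : 'I_n) : supp o v -> gen o v != 0.
Proof.
move=> sv; apply: contra_neq (oner_neq0 k) => /(congr1 (@tot k _)).
by rewrite !tot_supp.
Qed.

Lemma hom_ext_gen o N (f g : rep_hom (interval_rep k n o) N) (a : 'I_n) : o.2 = a ->
  f a (gen o a) = g a (gen o a) -> forall v r, f v r = g v r.
Proof.
move=> oa fg; have fga r : f a r = g a r.
  by rewrite (interval_scale_gen r) !linearZ /= fg.
move=> v r; have /orP[sv|sv] := orbN (supp o v); last by rewrite (row_eq0 r sv) !linear0.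
case: (eqVneq v a) => [e|ne]; first by move: r; rewrite e.
have e : nat_of_ord v = a.+1.
  move: ne sv; rewrite /supp oa -(inj_eq val_inj) /=; case: (o.1) => /=; lia.
have sa : supp o a by rewrite /supp oa; lia.
by have [s ->] := interval_arr_surj e r sa; rewrite !rep_hom_arr fga.
Qed.

Lemma hom_ext_socle o M (f g : rep_hom M (interval_rep k n o)) (b : 'I_n) :
  (o.2 + o.1)%N = b -> (forall x, f b x = g b x) -> forall v x, f v x = g v x.
Proof.
move=> ob fg v x.
have /orP[sv|sv] := orbN (supp o v); last by rewrite [LHS]row_eq0 // [RHS]row_eq0.
case: (eqVneq v b) => [e|ne]; first by move: x; rewrite e.
have e : nat_of_ord b = v.+1.
  move: ne sv; rewrite /supp -(inj_eq val_inj) /=; move: ob; case: (o.1) => /=; lia.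
apply: (interval_arr_inj (e := e)); first by rewrite /supp; lia.
by rewrite -!rep_hom_arr fg.
Qed.

(** The generator may go to any [x] when the interval has length two, its second basis vector
    following along the arrow; for a simple the arrow must kill [x]. *)
Lemma hom_from_gen o M (a : 'I_n) (x : M a) : o.2 = a ->
  (o.1 = false -> forall (j : 'I_n) (e : nat_of_ord j = a.+1), rep_arr M e x = 0) ->
  exists h : rep_hom (interval_rep k n o) M, h a (gen o a) = x.
Proof.
move=> oa o0.
have [m [ma mj]] : exists m : forall v, M v, m a = x /\
    forall (j : 'I_n) (e : nat_of_ord j = a.+1), m j = rep_arr M e x.
  have [lt|ge] := ltnP a.+1 n; last first.
    exists (@dfwith _ (fun v : 'I_n => M v : Type) (fun v => 0) a x); rewrite dfwith_in; split=> // j e.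
    by have := ltn_ord j; lia.
  pose b := Ordinal lt; have e : nat_of_ord b = a.+1 by [].
  have [|m [ma mb]] := @family_at n (fun v => M v : Type) (fun=> 0) a b x (rep_arr M e x).
    by move=> /(congr1 val) /=; lia.
  exists m; split=> // j ej; have jb : j = b by apply: val_inj.
  by move: ej; rewrite jb => ej; rewrite mb (arrow_irrelevance _ e ej).
have [|h hE] := @hom_from_interval k n o M m; last first.
  by exists h; rewrite hE tot_supp ?scale1r // /supp oa; lia.
move=> i j e si; have [ia|ne] := eqVneq i a; last first.
  have ea : nat_of_ord i = a.+1.
    by move: ne si; rewrite /supp oa -(inj_eq val_inj) /=; case: (o.1) => /=; lia.
  rewrite (mj _ ea) arrow_arrow (_ : supp o j = false) //.
  by rewrite /supp oa; case: (o.1) => /=; lia.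
move: si e; rewrite ia => _ e; rewrite ma (mj _ e) /supp oa e.
have /orP[o1|/negbTE o1] := orbN o.1; first by rewrite o1 addn1 leqnSn leqnn.
by rewrite o0 // mul0rn.
Qed.

(** Dual to [hom_from_gen]: the form at the left neighbor is [psi] composed with the arrow. *)
Lemma hom_to_socle o M (b : 'I_n) (psi : 'Hom(M b, k^o)) : (o.2 + o.1)%N = b ->
  (o.1 = false -> forall (i : 'I_n) (e : nat_of_ord b = i.+1) x, psi (rep_arr M e x) = 0) ->
  exists h : rep_hom M (interval_rep k n o), forall x, h b x = const_mx (psi x).
Proof.
move=> ob o0.
have [m [mb mj]] : exists m : forall v, 'Hom(M v, k^o), m b = psi /\
    forall (i : 'I_n) (e : nat_of_ord b = i.+1) x, m i x = psi (rep_arr M e x).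
  have [b0|bS] := posnP b.
    exists (@dfwith _ (fun v : 'I_n => 'Hom(M v, k^o) : Type) (fun v => 0) b psi).
    by rewrite dfwith_in; split=> // i e; lia.
  have lt : (b.-1 < n)%N by have := ltn_ord b; lia.
  pose a := Ordinal lt; have e : nat_of_ord b = a.+1 by rewrite /= prednK.
  have [|m [mb ma]] := @family_at n (fun v => 'Hom(M v, k^o) : Type) (fun=> 0) b a psi
    (psi \o rep_arr M e)%VF.
    by move=> /(congr1 val) /=; lia.
  exists m; split=> // j ej x; have jb : j = a by apply: val_inj; rewrite /= ej.
  by move: ej x; rewrite jb => ej x; rewrite ma comp_lfunE (arrow_irrelevance _ e ej).
have [|h hE] := @hom_to_interval k n o M m; last first.
  by exists h => x; rewrite hE mb.
move=> i j e x sj; have [jb|ne] := eqVneq j b; last first.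
  have ea : nat_of_ord b = j.+1.
    by move: ne sj; rewrite /supp -(inj_eq val_inj) /=; move: ob; case: (o.1) => /=; lia.
  rewrite (mj _ ea) arrow_arrow linear0 (_ : supp o i = false) //.
  by rewrite /supp; move: ob; case: (o.1) => /=; lia.
move: sj e; rewrite jb => _ e; rewrite mb (mj _ e).
have /orP[o1|/negbTE o1] := orbN o.1; last by rewrite o0 // mul0rn.
rewrite (_ : supp o i) //; rewrite /supp; move: ob; rewrite o1; lia.
Qed.

Lemma hom_zero_interval o o' : (o'.2 + o'.1 < n)%N ->
  ~~ [&& o'.2 <= o.2, o.2 <= o'.2 + o'.1 & o'.2 + o'.1 <= o.2 + o.1]%N ->
  hom_zero (interval_rep k n o) (interval_rep k n o').
Proof.
move=> on' no f v; apply/lfunP => r; rewrite lfunE /=.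
have /orP[sv|sv] := orbN (supp o v); last by rewrite (row_eq0 r sv) linear0.
have /orP[sv'|sv'] := orbN (supp o' v); last by apply: row_eq0.
(* If [o] starts first, the vectors at [v] come along an arrow from a vertex where [o'] vanishes.
   Otherwise [o'] ends last, and its injective arrow out of [v] meets a vertex where [o]
   vanishes. *)
have [lt|ge] := ltnP o.2 o'.2.
  have on : (o.2 < n)%N by have := ltn_ord v; move: sv; rewrite /supp; lia.
  have e : nat_of_ord v = (Ordinal on).+1.
    by move: sv sv'; rewrite /supp /=; case: (o.1) => /=; lia.
  have sa : supp o (Ordinal on) by rewrite /supp /=; lia.
  have [s ->] := interval_arr_surj e r sa.
  rewrite (rep_hom_arr f e s) [f _ s](@row_eq0 k (supp o' (Ordinal on))) ?linear0 //.
  by rewrite /supp /=; lia.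
have vn : (v.+1 < n)%N.
  by move: no sv sv'; rewrite /supp; lia.
pose w := Ordinal vn; have e : nat_of_ord w = v.+1 by [].
have sw' : supp o' w by move: no sv sv'; rewrite /supp /=; lia.
apply: (interval_arr_inj (e := e) sw'); rewrite linear0 -(rep_hom_arr f e r).
rewrite [rep_arr _ e r](@row_eq0 k (supp o w)) ?linear0 //.
by move: no sv sv'; rewrite /supp /=; case: (o'.1) => /=; case: (o.1) => /=; lia.
Qed.

Lemma hom_nonzero_interval o o' : (o.2 < n)%N ->
  [&& o'.2 <= o.2, o.2 <= o'.2 + o'.1 & o'.2 + o'.1 <= o.2 + o.1]%N ->
  ~ hom_zero (interval_rep k n o) (interval_rep k n o').
Proof.
move=> on oo' h0; have h : spreadable o o'.
  by move=> v; rewrite /supp; move: oo'; case: (o'.1); case: (o.1) => /=; lia.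
have := h0 (spread_hom k n h) (Ordinal on) => /lfunP/(_ (gen o (Ordinal on))).
rewrite spread_homE lfunE tot_supp; last by rewrite /supp /=; lia.
by apply/eqP/gen_neq0; rewrite /supp /=; lia.
Qed.

Definition rep_scale M (x : k) : rep_hom M M.
Proof.
refine (@RepHom k n M M (fun v => x *: \1%VF) _) => i j e.
by apply/lfunP => y; rewrite !comp_lfunE !scale_lfunE !id_lfunE linearZ.
Defined.

Lemma rep_scaleE M x v y : rep_scale M x v y = x *: y.
Proof. by rewrite scale_lfunE id_lfunE. Qed.

Lemma end_interval_scale o (f : rep_hom (interval_rep k n o) (interval_rep k n o)) :
  (o.2 < n)%N -> exists x, forall v r, f v r = x *: r.
Proof.
move=> on; pose a := Ordinal on.
exists (tot (f a (gen o a))) => v r.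
rewrite -rep_scaleE; apply: (@hom_ext_gen o _ _ _ a) => //.
by rewrite rep_scaleE -interval_scale_gen.
Qed.

Lemma end_iso_interval o : (o.2 < n)%N -> end_iso_field (interval_rep k n o).
Proof.
move=> on; exists (rep_scale _); split=> [a x y i|x y e|f].
- by rewrite /= scalerDl scalerA.
- have /lfunP/(_ (gen o (Ordinal on))) := e (Ordinal on).
  rewrite !rep_scaleE; apply: gen_scale_inj.
  by rewrite /supp /=; lia.
- have [x fE] := end_interval_scale f on; exists x => v; apply/lfunP => r.
  by rewrite rep_scaleE fE.
Qed.

Lemma interval_neq0 o : (o.2 < n)%N -> ~ rep_zero (interval_rep k n o).
Proof.
move=> on /rep_zeroP/(_ (Ordinal on) (gen o (Ordinal on))); apply/eqP/gen_neq0.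
by rewrite /supp /=; lia.
Qed.

Lemma rep_isoP M N : rep_iso M N <-> exists (f : rep_hom M N) (g : rep_hom N M),
  (forall i x, g i (f i x) = x) /\ (forall i x, f i (g i x) = x).
Proof.
split=> -[f [g [fK gK]]]; exists f, g; split=> i.
- by move=> x; rewrite -comp_lfunE fK id_lfunE.
- by move=> x; rewrite -comp_lfunE gK id_lfunE.
- by apply/lfunP => x; rewrite comp_lfunE id_lfunE fK.
- by apply/lfunP => x; rewrite comp_lfunE id_lfunE gK.
Qed.

Lemma dsum_arrE (A B : rep k n) (i j : 'I_n) (e : nat_of_ord j = i.+1) (x : rep_dsum A B i) :
  rep_arr (rep_dsum A B) e x = (rep_arr A e x.1, rep_arr B e x.2).
Proof. by rewrite lfunE. Qed.

(** The projection onto a summand is an idempotent endomorphism, hence the scalar 0 or 1. *)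
Lemma indecomposable_interval o : (o.2 < n)%N -> indecomposable (interval_rep k n o).
Proof.
move=> on; split=> [|A B]; first exact: interval_neq0.
move=> /rep_isoP[f [g [fK gK]]].
have [||e eE] := @rep_hom_of k n (interval_rep k n o) (interval_rep k n o)
    (fun v r => g v ((f v r).1, 0)).
- move=> v a r s; rewrite -[RHS]linearP; congr (g v _); rewrite linearP.
  by apply: injective_projections => //=; rewrite scaler0 addr0.
- move=> i j e r; rewrite rep_hom_arr dsum_arrE -rep_hom_arr dsum_arrE /=.
  by rewrite linear0.
have [x xE] := end_interval_scale e on.
have xx : x * x = x.
  have : e (Ordinal on) (e _ (gen o (Ordinal on))) = e _ (gen o _) by rewrite !eE gK.
  have so : supp o (Ordinal on) by rewrite /supp /=; lia.
  by rewrite !xE [LHS]scalerA => /(gen_scale_inj so).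
have /orP[/eqP x0|/eqP x1] : (x == 0) || (x == 1).
  by rewrite -[x == 1]subr_eq0 -mulf_eq0 mulrBr mulr1 xx subrr.
- left; apply/rep_zeroP => v y; have := eE v (g v (y, 0)).
  rewrite xE x0 scale0r gK /= => /(congr1 (f v)).
  by rewrite linear0 gK => -[<-].
- right; apply/rep_zeroP => v y; have := eE v (g v (0, y)).
  rewrite xE x1 scale1r gK /= => /(congr1 (f v)).
  by rewrite !gK => -[].
Qed.

Lemma interval_iso_inj o o' : (o.2 < n)%N -> (o.2 + o.1 < n)%N -> (o'.2 + o'.1 < n)%N ->
  rep_iso (interval_rep k n o) (interval_rep k n o') -> o = o'.
Proof.
move=> on oon oon' /rep_isoP[f [g [fK gK]]].
have so : supp o (Ordinal on) by rewrite /supp /=; lia.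
have h01 : ~ hom_zero (interval_rep k n o) (interval_rep k n o').
  by move=> h0; have := gen_neq0 so; rewrite -[gen o _]fK h0 lfunE linear0 eqxx.
have h10 : ~ hom_zero (interval_rep k n o') (interval_rep k n o).
  by move=> h0; have := gen_neq0 so; rewrite -[gen o _]fK h0 lfunE eqxx.
have := contra_not (@hom_zero_interval o o' oon') h01.
have := contra_not (@hom_zero_interval o' o oon) h10.
case: o o' {on oon so f g fK gK h01 h10} oon' => [b a] [b' a'] /= _ /negP/negPn h /negP/negPn h'.
by congr (_, _); lia.
Qed.

(** It suffices to lift the image of the generator. The zero modules with [a >= n] are included
    because they end the resolutions of simples. *)
Lemma projective_interval a : projective (interval_rep k n (true, a)).
Proof.
move=> A B g f epi; have [ge|an] := leqP n a.
  have [|h hE] := @hom_from_interval k n (true, a) A (fun=> 0).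
    by move=> i j e; rewrite /supp /= => ?; have := ltn_ord i; lia.
  exists h => v; apply/lfunP => r; rewrite (row_eq0 r) ?linear0 //.
  by rewrite /supp /=; have := ltn_ord v; lia.
pose a0 := Ordinal an.
have : f a0 (gen (true, a) a0) \in limg (g a0) by rewrite epi memvf.
case/memv_imgP => x _ gx.
have [|//|h hE] := @hom_from_gen (true, a) A a0 x _; first by [].
exists h => v; apply/lfunP => r; rewrite comp_lfunE.
have [gh ghE] := rep_hom_comp h g; rewrite -ghE.
by apply: (@hom_ext_gen _ _ _ _ a0) => //; rewrite ghE hE.
Qed.

End Homs.

(** * Extensions between interval modules *)

Section Ext.
Variables (k : fieldType) (n : nat).
Implicit Types (M N : rep k n) (o : bool * nat) (d : bool).

Lemma lfun_factor (U V W : vectType k) (f : 'Hom(U, V)) (psi : 'Hom(U, W)) :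
  (forall x, f x = 0 -> psi x = 0) -> exists phi : 'Hom(V, W), forall x, phi (f x) = psi x.
Proof.
move=> h; exists (psi \o f^-1)%VF => x; rewrite comp_lfunE.
have := h ((f^-1)%VF (f x) - x); rewrite !linearB /= limg_lfunVK ?memv_img ?memvf //.
by rewrite subrr => /(_ erefl)/eqP; rewrite subr_eq0 => /eqP.
Qed.

Lemma exact_atP M N L (f : rep_hom M N) (g : rep_hom N L) v y :
  exact_at f g -> g v y = 0 <-> exists x, y = f v x.
Proof.
move=> fg; split=> [gy|[x ->]].
  by have : y \in lker (g v); [rewrite memv_ker gy | rewrite -fg => /memv_imgP[x _ ->]; exists x].
by apply/eqP; rewrite -memv_ker -fg; apply/memv_img/memvf.
Qed.

(** These intervals are injective: morphisms into them are linear forms at the socle vertex [b], so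
    the Hom complex is dual to the exact complex of spaces at [b]. *)
Lemma ext_zero_injective o N q : (o.2 + o.1 < n)%N -> o.1 || (o.2 == 0)%N ->
  ext_zero q.+1 N (interval_rep k n o).
Proof.
move=> on oi P f zf; pose b := Ordinal on.
pose psi : 'Hom(P q.+1 b, k^o) := (tot_lfun k (supp o b) \o f b)%VF.
have psiE x : psi x = tot (f b x) by rewrite comp_lfunE tot_lfunE.
have [x /(exact_atP _ (res_exact P q))[y ->]|phi phiE] := @lfun_factor _ _ _ (res_d P q b) psi.
  by rewrite psiE -comp_lfunE zf lfunE [LHS]tot0.
have [||g gE] := @hom_to_socle k n o (P q) b phi; [by [] | |].
  (* The simple case is S_0, and no arrow ends at vertex 0. *)
  by move=> o1 i e; move: e oi; rewrite o1 /= => e /eqP; lia.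
have [h hE] := rep_hom_comp (res_d P q) g.
exists g => v; apply/lfunP => x; rewrite comp_lfunE -hE.
apply: (@hom_ext_socle _ _ _ _ _ _ b) => // y.
by rewrite hE gE phiE psiE const_tot.
Qed.

Lemma cover_spreadable a : spreadable (true, a) (false, a).
Proof. by move=> v; rewrite /supp /=; lia. Qed.

Lemma cover_epi a : rep_epi (spread_hom k n (@cover_spreadable a)).
Proof.
move=> v; apply/eqP; rewrite eqEsubv subvf; apply/subvP => r _.
apply/memv_imgP; exists (const_mx (tot r)); rewrite ?memvf // spread_homE.
have /orP[sv|sv] := orbN (supp (false, a) v); last by rewrite [LHS]row_eq0 // [RHS]row_eq0.
by rewrite tot_supp ?const_tot //; move: sv; rewrite /supp /=; lia.
Qed.

(* Every morphism from [M] to the simple module at [j] lifts along its projective cover. *)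
Definition lifts M (j : 'I_n) : Prop :=
  forall (l : 'I_n) (e : nat_of_ord l = j.+1) (chi : 'Hom(M j, k^o)),
  (forall (i : 'I_n) (e' : nat_of_ord j = i.+1) x, chi (rep_arr M e' x) = 0) ->
  exists chi' : 'Hom(M l, k^o), forall x, chi' (rep_arr M e x) = chi x.

Lemma projective_lifts M j : projective M -> lifts M j.
Proof.
move=> pM l e chi chi0.
have [||f fE] := @hom_to_socle k n (false, nat_of_ord j) M j chi; [exact: addn0 | by [] |].
have [h hE] := pM _ _ (spread_hom k n (@cover_spreadable j)) f (@cover_epi j).
have sl : supp (true, nat_of_ord j) l by rewrite /supp /=; lia.
have sj : supp (false, nat_of_ord j) j by rewrite /supp /=; lia.
exists (tot_lfun k (supp (true, nat_of_ord j) l) \o h l)%VF => x.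
rewrite comp_lfunE tot_lfunE (rep_hom_arr h e x) interval_arr tot_supp //.
have /lfunP/(_ x) := hE j; rewrite comp_lfunE spread_homE fE => /(congr1 (@tot k _)).
by rewrite !tot_supp.
Qed.

Lemma simple_lifts a j : nat_of_ord j <> a -> lifts (interval_rep k n (false, a)) j.
Proof.
move=> ja l e chi _; exists 0 => x.
by rewrite lfunE (row_eq0 x) ?linear0 // /supp /=; lia.
Qed.

(** [psi] is a cocycle of degree q+1 with values in S_j, read as a linear form. Exactness yields
    [psi'] with the right composite, but it may be nonzero on the incoming arrow; the defect is a
    cocycle of degree q with values in S_(j-1). *)
Lemma simple_shift N (P : proj_resolution N) (m : nat) : forall (j : 'I_n) q, nat_of_ord j = m ->
  (forall j' : 'I_n, (j' < j)%N -> lifts N j') ->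
  forall psi : 'Hom(P q.+1 j, k^o),
  (forall (i : 'I_n) (e : nat_of_ord j = i.+1) x, psi (rep_arr (P q.+1) e x) = 0) ->
  (forall x, psi (res_d P q.+1 j x) = 0) ->
  exists phi : 'Hom(P q j, k^o),
    (forall (i : 'I_n) (e : nat_of_ord j = i.+1) x, phi (rep_arr (P q) e x) = 0) /\
    (forall x, phi (res_d P q j x) = psi x).
Proof.
elim: m => [|m IHm] j q jm lN psi psi0 psid.
all: have [x /(exact_atP _ (res_exact P q))[y ->] //|psi' psiE] :=
  @lfun_factor _ _ _ (res_d P q j) psi.
  by exists psi'; split=> // i e; lia.
have mn : (m < n)%N by have := ltn_ord j; lia.
pose i := Ordinal mn; have e : nat_of_ord j = i.+1 by [].
have di (l : 'I_n) (el : nat_of_ord j = l.+1) : l = i by apply: val_inj => /=; lia.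
(* The defect of [psi'], to be cancelled by a form [beta] that kills boundaries. *)
pose alpha := (psi' \o rep_arr (P q) e)%VF.
have alphaE x : alpha x = psi' (rep_arr (P q) e x) by rewrite comp_lfunE.
have alpha0 (l : 'I_n) (el : nat_of_ord i = l.+1) x : alpha (rep_arr (P q) el x) = 0.
  by rewrite alphaE arrow_arrow linear0.
have alphad x : alpha (res_d P q i x) = 0.
  by rewrite alphaE -rep_hom_arr psiE psi0.
suff [beta [betad betaE]] : exists beta : 'Hom(P q j, k^o),
    (forall x, beta (res_d P q j x) = 0) /\ (forall x, beta (rep_arr (P q) e x) = alpha x).
  exists (psi' - beta); split=> [l el x|x].
    have li := di l el; subst l.
    by rewrite (arrow_irrelevance _ el e) !lfunE /= lfunE /= betaE alphaE subrr.
  by rewrite !lfunE /= lfunE /= betad subr0 psiE.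
have ltij : (i < j)%N by rewrite e.
case: q psi psi0 psid psi' psiE @alpha alphaE alpha0 alphad =>
  [|q] psi psi0 psid psi' psiE alpha alphaE alpha0 alphad.
  (* In degree zero [alpha] descends along the augmentation to a morphism from [N] to S_(j-1), which
     lifts by [lN]. *)
  have [x /(exact_atP _ (res_exact0 P))[y ->] //|chi chiE] := @lfun_factor _ _ _ (res_aug P i) alpha.
  have [l el y|chi' chi'E] := lN i ltij j e chi.
    have : y \in limg (res_aug P l) by rewrite res_epi memvf.
    by case/memv_imgP => x _ ->; rewrite -rep_hom_arr chiE alpha0.
  exists (chi' \o res_aug P j)%VF; split=> x; rewrite comp_lfunE.
    rewrite (_ : res_aug P j _ = 0) ?linear0 //.
    by apply/(exact_atP _ (res_exact0 P)); exists x.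
  by rewrite rep_hom_arr chi'E chiE.
have lNi (l : 'I_n) : (l < i)%N -> lifts N l by move=> li; apply: lN; lia.
(* In positive degree [alpha] is the coboundary of some [chi] by induction. Lift [chi] along the
   arrow, by projectivity, and compose with the differential. *)
have [chi [chi0 chiE]] := IHm i q erefl lNi alpha alpha0 alphad.
have [//|chi' chi'E] := @projective_lifts _ i (@res_proj _ _ _ P q) j e chi.
exists (chi' \o res_d P q j)%VF; split=> x; rewrite comp_lfunE.
  rewrite (_ : res_d P q j _ = 0) ?linear0 //.
  by apply/(exact_atP _ (res_exact P q)); exists x.
by rewrite rep_hom_arr chi'E chiE.
Qed.

Lemma ext_zero_simple N (j : 'I_n) q : (forall j' : 'I_n, (j' < j)%N -> lifts N j') ->
  ext_zero q.+1 N (interval_rep k n (false, nat_of_ord j)).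
Proof.
set o := (false, nat_of_ord j); move=> lN P f zf.
pose psi : 'Hom(P q.+1 j, k^o) := (tot_lfun k (supp o j) \o f j)%VF.
have psiE x : psi x = tot (f j x) by rewrite comp_lfunE tot_lfunE.
have [i e x|x|phi [phi0 phiE]] := simple_shift erefl lN (psi := psi).
- rewrite psiE rep_hom_arr (row_eq0 (f i x)) ?linear0 ?[LHS]tot0 //.
  by rewrite /supp /=; lia.
- by rewrite psiE -comp_lfunE zf lfunE [LHS]tot0.
have [||g gE] := @hom_to_socle k n o (P q) j phi; [exact: addn0 | by [] |].
have [h hE] := rep_hom_comp (res_d P q) g.
exists g => v; apply/lfunP => x; rewrite comp_lfunE -hE.
apply: (@hom_ext_socle _ _ _ _ _ _ j); first exact: addn0.
by move=> y; rewrite hE gE phiE psiE const_tot.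
Qed.

Lemma ext_zero_interval o o' q : (o'.2 + o'.1 < n)%N -> [|| o.1, o'.1 | o'.2 <= o.2]%N ->
  ext_zero q.+1 (interval_rep k n o) (interval_rep k n o').
Proof.
move=> on'; case: o' on' => [[] a'] /= on' => [_|]; first exact: ext_zero_injective.
have a'n : (a' < n)%N by lia.
move=> h; apply: (@ext_zero_simple _ (Ordinal a'n)) => j /= ja.
case: o h => [[] a] /= h; first exact/projective_lifts/projective_interval.
by apply: simple_lifts; lia.
Qed.

(** A one-dimensional middle term is exact when exactly one of its neighbors is nonzero. *)
Lemma spread_exact (d1 d2 d3 : bool) : (d2 -> d1 = ~~ d3) ->
  limg (linfun (@spread k d1 d2)) = lker (linfun (@spread k d2 d3)).
Proof.
move=> h; apply/vspaceP => r; rewrite memv_ker lfunE /=; apply/memv_imgP/eqP => [[s _ ->]|].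
  rewrite lfunE /= /spread tot_const.
  have /orP[t3|f3] := orbN d3; last exact: row_eq0.
  have /orP[t2|/negbTE->] := orbN d2; last by rewrite mulr0n.
  by rewrite (row_eq0 s) ?tot0 ?mul0rn // h // t3.
move=> r0; exists (const_mx (tot r)); rewrite ?memvf // lfunE /= /spread tot_const.
have /orP[t2|f2] := orbN d2; last by rewrite [LHS]row_eq0 // [RHS]row_eq0.
have /orP[t3|f3] := orbN d3; last by rewrite h // f3 const_tot.
suff -> : r = 0 by rewrite tot0 mul0rn.
move: r0 => /(congr1 (@tot k _)); rewrite tot_const t3 mulr1n tot0 => r0.
by rewrite -[r]const_tot r0.
Qed.

Lemma syzygy_spreadable a : spreadable (true, a.+1) (true, a).
Proof. by move=> v; rewrite /supp /=; lia. Qed.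

(** The terms past the last vertex are zero. The index is [q + a] because [q.+1 + a] computes to
    [(q + a).+1]. *)
Definition simple_resolution a : proj_resolution (interval_rep k n (false, a)).
Proof.
refine (@ProjResolution k n _ (fun q => interval_rep k n (true, q + a)%N)
  (fun q => spread_hom k n (@syzygy_spreadable (q + a)))
  (spread_hom k n (@cover_spreadable a)) _ _ _ _) => [q|v|v|q v].
- exact: projective_interval.
- exact: cover_epi.
- by apply: spread_exact; rewrite /supp /=; lia.
- by apply: spread_exact; rewrite /supp /=; lia.
Defined.

(** The projective cover of the second simple is a cocycle on [simple_resolution]. It is no
    coboundary, since the preceding term has no nonzero morphism to that simple. *)
Lemma ext_nonzero_simple a q : (a + q.+1 < n)%N ->
  ~ ext_zero q.+1 (interval_rep k n (false, a)) (interval_rep k n (false, a + q.+1)%N).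
Proof.
move=> aq; have -> : (a + q.+1 = q.+1 + a)%N by rewrite addnC.
move=> ext0.
pose f := spread_hom k n (@cover_spreadable (q.+1 + a)).
have [v|g gE] := ext0 (simple_resolution a) f.
  apply/lfunP => r; rewrite comp_lfunE zero_lfunE spread_homE [res_d _ _ _ _]spread_homE tot_const.
  have [h|h] := boolP (v == (q.+1 + a)%N :> nat); last first.
    by apply: row_eq0; move: h; rewrite /supp /=; lia.
  rewrite (row_eq0 r) ?tot0 ?mul0rn //.
  by move: h; rewrite /supp /=; lia.
have qn : (q.+1 + a < n)%N by rewrite addnC.
pose j := Ordinal qn.
have g0 : g j = 0.
  by apply: (@hom_zero_interval k n (true, q + a)%N (false, q.+1 + a)%N) => /=; lia.
have sj : supp (false, q.+1 + a)%N j by rewrite /supp /=; lia.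
have := gE j => /lfunP/(_ (gen k (true, q.+1 + a)%N j)).
rewrite comp_lfunE g0 zero_lfunE spread_homE tot_supp; last by rewrite /supp /=; lia.
by apply/eqP/(gen_neq0 k sj).
Qed.

End Ext.

(** * Classification of the indecomposable modules *)

Section Kernels.
Variables (k : fieldType) (n : nat) (M X : rep k n) (p : rep_hom M X).

Definition ker_arr (i j : 'I_n) (e : nat_of_ord j = i.+1) :
    'Hom(subvs_of (lker (p i)), subvs_of (lker (p j))) :=
  linfun (vsproj (lker (p j)) \o rep_arr M e \o vsval).

Lemma val_ker_arr (i j : 'I_n) (e : nat_of_ord j = i.+1) c :
  vsval (ker_arr e c) = rep_arr M e (vsval c).
Proof.
rewrite lfunE /= vsprojK // memv_ker rep_hom_arr.
by have := subvsP c; rewrite memv_ker => /eqP ->; rewrite linear0.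
Qed.

Lemma ker_rad2 (i j l : 'I_n) (ij : nat_of_ord j = i.+1) (jl : nat_of_ord l = j.+1) :
  (ker_arr jl \o ker_arr ij)%VF = 0.
Proof.
apply/lfunP => c; apply: subvs_inj.
by rewrite comp_lfunE zero_lfunE !val_ker_arr arrow_arrow linear0.
Qed.

Definition rep_ker : rep k n :=
  @Rep k n (fun i => subvs_of (lker (p i)) : vectType k) ker_arr ker_rad2.

(** [M] is the direct sum of [X] and the kernel of [p], so the kernel vanishes and [p], [s] are
    inverse to each other. *)
Lemma retract_iso (s : rep_hom X M) : (forall v r, p v (s v r) = r) ->
  indecomposable M -> ~ rep_zero X -> rep_iso M X.
Proof.
move=> sK [_ indM] Xn0.
have kerP v x : x - s v (p v x) \in lker (p v).
  by rewrite memv_ker linearB /= sK subrr.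
have [||f fE] := @rep_hom_of k n M (rep_dsum X rep_ker)
    (fun v x => (p v x, vsproj (lker (p v)) (x - s v (p v x)))).
- move=> v a x y; apply: injective_projections => /=; first by rewrite linearP.
  rewrite -[RHS]linearP; congr (vsproj _ _).
  by rewrite !linearP /= addrACA -scalerDr.
- move=> i j e x; rewrite dsum_arrE /=; congr (_, _); first exact: rep_hom_arr.
  apply: subvs_inj; rewrite val_ker_arr (vsprojK (kerP j _)).
  transitivity (rep_arr M e (x - s i (p i x))); first by rewrite linearB /= !rep_hom_arr.
  exact: (congr1 (rep_arr M e) (esym (vsprojK (kerP i x)))).
have [||g gE] := @rep_hom_of k n (rep_dsum X rep_ker) M
    (fun v y => s v y.1 + vsval y.2).
- by move=> v a y z /=; rewrite !linearP scalerDr addrACA.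
- by move=> i j e y; rewrite dsum_arrE /= rep_hom_arr val_ker_arr linearD.
have [|//|/rep_zeroP zK] := indM X rep_ker.
  apply/rep_isoP; exists f, g; split=> v x.
    by rewrite gE fE /= (vsprojK (kerP v x)) addrC subrK.
  have pk : p v (vsval x.2) = 0.
    by apply/eqP; rewrite -memv_ker subvsP.
  rewrite fE gE linearD /= sK pk addr0 addrC addKr vsvalK.
  by case: x {pk}.
apply/rep_isoP; exists p, s; split=> // v x.
apply/eqP; rewrite eq_sym -subr_eq0 -(vsprojK (kerP v x)).
by rewrite (zK v (vsproj _ _)) linear0.
Qed.

End Kernels.

Section Classification.
Variables (k : fieldType) (n : nat).
Implicit Types (M N : rep k n) (o : bool * nat) (d : bool).

Lemma lfun_neq0P (U V : vectType k) (f : 'Hom(U, V)) : f != 0 -> exists x, f x != 0.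
Proof.
move=> f0; have : vpick (limg f) \in limg f by apply: memv_pick.
case/memv_imgP => x _ fx; exists x; rewrite -fx vpick0.
apply: contra_neq f0 => f0; apply/lfunP => y; rewrite zero_lfunE.
by apply/eqP; rewrite -memv0 -f0; apply/memv_img/memvf.
Qed.

Lemma functional_eq1 (V : vectType k) (y : V) : y != 0 -> exists psi : 'Hom(V, k^o), psi y = 1.
Proof.
move=> y0; have lin : linear (fun c : k^o => c *: y).
  by move=> a c d; rewrite scalerDl scalerA.
pose L : {linear k^o -> V} :=
  HB.pack_for {linear k^o -> V} (fun c : k^o => c *: y) (GRing.isLinear.Build _ _ _ _ _ lin).
have LE c : linfun L c = c *: y by rewrite lfunE.
have [x|psi psiE] := @lfun_factor k _ _ _ (linfun L) \1%VF.
  by rewrite LE id_lfunE => /eqP; rewrite scaler_eq0 (negPf y0) orbF => /eqP.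
by exists psi; have := psiE 1; rewrite LE scale1r id_lfunE.
Qed.

Lemma indecomposable_classification M : indecomposable M ->
  exists2 o : bool * nat, (o.2 + o.1 < n)%N & rep_iso M (interval_rep k n o).
Proof.
move=> indM.
(* A Boolean test for a nonzero arrow; [=P] supplies the proof that [rep_arr] takes as argument. *)
pose nz (i j : 'I_n) :=
  if nat_of_ord j =P i.+1 is ReflectT e then rep_arr M e != 0 else false.
have [/existsP[i /existsP[j]]|no] := boolP [exists i, exists j, nz i j].
  rewrite /nz; case: eqP => // e /lfun_neq0P[x /functional_eq1[psi psix]].
  exists (true, nat_of_ord i); first by rewrite /= addn1 -e.
  have [||s sE] := @hom_from_gen k n (true, nat_of_ord i) M i x; [by [] | by [] |].
  have [||p pE] := @hom_to_socle k n (true, nat_of_ord i) M j psi; [by rewrite /= addn1 -e | by [] |].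
  apply: (retract_iso (p := p) (s := s)) => //; last by apply: interval_neq0; apply: (ltn_ord i).
  (* The composite of [s] and [p] is compared on the generator with scaling by 1, which serves as
     the identity morphism. *)
  have [h hE] := rep_hom_comp s p => v r; rewrite -hE -[RHS]scale1r -rep_scaleE.
  have sj : supp (true, nat_of_ord i) j by rewrite /supp /=; lia.
  have si : supp (true, nat_of_ord i) i by rewrite /supp /=; lia.
  apply: (@hom_ext_gen _ _ _ _ _ _ i) => //.
  rewrite hE sE rep_scaleE scale1r; apply: (interval_arr_inj (e := e) sj).
  by rewrite -rep_hom_arr pE psix interval_arr tot_supp.
have arr0 (i j : 'I_n) (e : nat_of_ord j = i.+1) x : rep_arr M e x = 0.
  have : ~~ nz i j by apply: contra no => h; apply/existsP; exists i; apply/existsP; exists j.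
  rewrite /nz; case: eqP => // e' /negPn/eqP a0.
  by rewrite (arrow_irrelevance _ e e') a0 zero_lfunE.
have [/forallP z|] := boolP [forall i : 'I_n, \dim {: M i} == 0%N].
  by case: (indM.1) => i; apply/eqP/z.
rewrite negb_forall => /existsP[i]; rewrite dimv_eq0 -vpick0.
set x := vpick _ => x0; have [psi psix] := functional_eq1 x0.
exists (false, nat_of_ord i); first by rewrite /= addn0 ltn_ord.
have [||s sE] := @hom_from_gen k n (false, nat_of_ord i) M i x; [by [] | by move=> *; apply: arr0 |].
have [||p pE] := @hom_to_socle k n (false, nat_of_ord i) M i psi.
- exact: addn0.
- by move=> _ l e y; rewrite arr0 linear0.
apply: (retract_iso (p := p) (s := s)) => //; last by apply: interval_neq0; apply: (ltn_ord i).
have [h hE] := rep_hom_comp s p => v r; rewrite -hE -[RHS]scale1r -rep_scaleE.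
apply: (@hom_ext_gen _ _ _ _ _ _ i) => //.
by rewrite hE sE rep_scaleE scale1r pE psix.
Qed.

(** * Exceptional sequences as valid words *)

Lemma exceptional_interval o : (o.2 + o.1 < n)%N -> exceptional (interval_rep k n o).
Proof.
move=> on; have on' : (o.2 < n)%N by lia.
split; [exact: indecomposable_interval | exact: end_iso_interval |].
by case=> // q _; apply: ext_zero_interval; rewrite // leqnn !orbT.
Qed.

Lemma pair_ok_interval o' o : (o'.2 + o'.1 < n)%N -> (o.2 + o.1 < n)%N ->
  (hom_zero (interval_rep k n o) (interval_rep k n o') /\
   forall q, ext_zero q.+1 (interval_rep k n o) (interval_rep k n o')) <-> pair_ok o' o.
Proof.
move=> on' on; split=> [[h0 e0]|/andP[h e]]; last first.
  by split=> [|q]; [apply: hom_zero_interval | apply: ext_zero_interval].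
apply/andP; split.
  by apply/negP => h; apply: hom_nonzero_interval h h0; lia.
case: o o' on' on h0 e0 => [[] a] [[] a'] //= on' on _ e0.
(* The nonvanishing degree is [a' - a], written as a successor. *)
rewrite leqNgt; apply/negP => aa'; apply: (@ext_nonzero_simple k n a (a' - a).-1); first lia.
have -> : (a + (a' - a).-1.+1 = a')%N by lia.
exact: e0.
Qed.

Lemma hom_zero_iso M M' N N' : rep_iso M M' -> rep_iso N N' -> hom_zero N M -> hom_zero N' M'.
Proof.
move=> /rep_isoP[f [f' [fK f'K]]] /rep_isoP[g [g' [gK g'K]]] h0 h v.
apply/lfunP => x; rewrite zero_lfunE.
have [h1 h1E] := rep_hom_comp g h; have [h2 h2E] := rep_hom_comp h1 f'.
by rewrite -[LHS]f'K -[x]g'K -h1E -h2E h0 zero_lfunE linear0.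
Qed.

(** A resolution of [N'] becomes one of [N] by composing its augmentation with the isomorphism; the
    terms and differentials stay the same. *)
Lemma ext_zero_iso M M' N N' q : rep_iso M M' -> rep_iso N N' ->
  ext_zero q.+1 N M -> ext_zero q.+1 N' M'.
Proof.
move=> /rep_isoP[f [f' [fK f'K]]] /rep_isoP[g [g' [gK g'K]]] e0 P h zh.
have [aug augE] := rep_hom_comp (res_aug P) g'.
have aug_epi : rep_epi aug.
  move=> v; apply/eqP; rewrite eqEsubv subvf; apply/subvP => y _.
  have : g v y \in limg (res_aug P v) by rewrite res_epi memvf.
  case/memv_imgP => x _ yx; apply/memv_imgP; exists x; rewrite ?memvf //.
  by rewrite augE -yx gK.
have aug_exact : exact_at (res_d P 0) aug.
  move=> v; rewrite res_exact0; apply/vspaceP => x; rewrite !memv_ker augE.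
  apply/eqP/eqP => [->|h0]; first by rewrite linear0.
  by rewrite -[LHS]g'K h0 linear0.
pose Q := @ProjResolution k n N (res_ob P) (res_d P) aug (@res_proj _ _ _ P) aug_epi
  aug_exact (res_exact P).
have [h1 h1E] := rep_hom_comp h f'.
have [v|t tE] := e0 Q h1.
  apply/lfunP => x; have /lfunP/(_ x) := zh v.
  by rewrite !comp_lfunE h1E !zero_lfunE => ->; rewrite linear0.
have [t' t'E] := rep_hom_comp t f.
exists t' => v; apply/lfunP => x; rewrite comp_lfunE t'E -[LHS]f'K -h1E tE.
by rewrite comp_lfunE.
Qed.

Lemma exceptional_seq_classes :
  num_classes (@complete_exceptional_seq k n) (@seq_iso k n n) #|idempotent_ffuns n|.
Proof.
pose S (a : 'I_#|idempotent_ffuns n|) (i : 'I_n) := interval_rep k n (word (enum_val a) i).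
have Sw a : valid_word (word (@enum_val _ (mem (idempotent_ffuns n)) a)).
  by apply/word_valid/enum_valP.
exists S; split=> [a|a b ab|x [xex xpair]].
- have [w1 w2] := Sw a.
  split=> [i|i j /w2]; first exact: exceptional_interval.
  move=> /pair_ok_interval[] // h e; split=> //; try exact: exceptional_interval.
  by case=> // q _; apply: e.
- apply/enum_val_inj/word_inj; [exact: enum_valP|exact: enum_valP|] => i.
  have [/(_ i) wa _] := Sw a; have [/(_ i) wb _] := Sw b.
  by apply: interval_iso_inj (ab i) => //; apply: leq_ltn_trans (leq_addr _ _) wa.
have [w hw] : exists w : 'I_n -> bool * nat, forall i,
    ((w i).2 + (w i).1 < n)%N /\ rep_iso (x i) (interval_rep k n (w i)).
  apply: (fin_all_exists (P := fun i o => (o.2 + o.1 < n)%N /\ rep_iso (x i) (interval_rep k n o))).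
  move=> i; have [ind _ _] := xex i.
  by have [o on io] := indecomposable_classification ind; exists o.
have vw : valid_word w.
  split=> [i|i j ij]; first by case: (hw i).
  have [wi xi] := hw i; have [wj xj] := hw j; have [_ _ h e] := xpair i j ij.
  apply/pair_ok_interval => //; split=> [|q]; first exact: hom_zero_iso h.
  exact: ext_zero_iso (e q.+1 isT).
have [f fI fw] := word_surj vw.
exists (enum_rank_in fI f) => i; rewrite /S enum_rankK_in // fw.
by case: (hw i).
Qed.

End Classification.

Theorem theorem1p2 (k : closedFieldType) (n : nat) (hn : (1 <= n)%N) :
  num_classes (@complete_exceptional_seq k n) (@seq_iso k n n)
    #|idempotent_ffuns n| /\
  #|idempotent_ffuns n| = #|rooted_forests_height_le1 'I_n|.
Proof.
split; first exact: exceptional_seq_classes.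
have starI : {in idempotent_ffuns n &, injective (@star_forest 'I_n)}.
  by move=> f f' /idempotentP ff /idempotentP ff'; apply: star_forest_inj.
rewrite -(card_in_imset starI); apply: eq_card => -[E R].
apply/imsetP/idP => [[f /idempotentP ff ->]|/star_forest_surj[f /idempotentP ff <-]].
  exact: star_forestP.
by exists f.
Qed.
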